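(* Let $\mathcal{M} = S^1$, let $\mathcal{X} = \mathbb{R}^n$, and let $g : \mathcal{M} \to \mathcal{X}$ be a homeomorphism onto its image $\mathcal{M}_x = g(\mathcal{M})$. Let $h_{\phi(t)} : \mathcal{X} \to \mathbb{R}^2$, $t \in [0,1]$, be a family of maps such that $(x,t) \mapsto h_{\phi(t)}(x)$ is a continuous function of both $x \in \mathcal{M}_x$ and $t \in [0,1]$, and assume that $h_{\phi(t)}(x) \neq (0,0)$ for all $t \in [0,1]$ and $x \in \mathcal{M}_x$. Let $\pi : \mathbb{R}^2 \setminus \{(0,0)\} \to S^1$, $\pi(y) = y/\|y\|$, and define $\psi_{\phi(t)} = \pi \circ h_{\phi(t)} \circ g : S^1 \to S^1$. Then the winding numbers of the initial and final maps are equal: $$w(\psi_{\phi(0)}) = w(\psi_{\phi(1)}).$$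
   Context: The winding number (degree) $w(\psi) \in \mathbb{Z}$ of a continuous map $\psi : S^1 \to S^1$ is $w(\psi) = \frac{1}{2\pi} \int_{S^1} d\psi(\theta)$, i.e. the total signed change of the angle of $\psi(\theta)$ as $\theta$ traverses the circle once, divided by $2\pi$; equivalently, the topological degree of $\psi$. The maps $h_{\phi(t)}$ model a network whose parameters $\phi(t)$ evolve continuously from initialization ($t=0$) to the end of training ($t=1$). *)

(* Defs.v *)
From HB Require Import structures.
From mathcomp Require Import all_boot all_order all_algebra.
From mathcomp Require Import ring lra.
From mathcomp Require Import all_classical all_reals all_analysis.

Set Implicit Arguments.
Unset Strict Implicit.
Unset Printing Implicit Defensive.

Import Order.TTheory GRing.Theory Num.Theory.
Import numFieldNormedType.Exports.

Local Open Scope classical_set_scope.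
Local Open Scope ring_scope.

(* Euclidean norm: the library norm on the product R * R is the sup norm. *)
Definition norm2 (R : realType) (y : R * R) : R :=
  Num.sqrt (y.1 ^+ 2 + y.2 ^+ 2).

Definition circle (R : realType) : set (R * R) := [set p | norm2 p = 1].

(* Maps on a subspace A are total functions constrained only on A. *)
Definition homeo_onto_image (S T : topologicalType) (A : set S) (g : S -> T) :=
  {within A, continuous g} /\
  exists ginv : T -> S,
    {in A, cancel g ginv} /\ {within g @` A, continuous ginv}.

(* y / |y|, meaningful for y != (0, 0) only. *)
Definition circle_proj (R : realType) (y : R * R) : R * R :=
  ((norm2 y)^-1 * y.1, (norm2 y)^-1 * y.2).

Definition circle_pt (R : realType) (s : R) : R * R := (cos s, sin s).

(* theta is a continuous choice of the angle of psi (e^(is)), 0 <= s <= 2 pi. *)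
Definition angle_lift (R : realType) (psi : R * R -> R * R) (theta : R -> R) :=
  {within `[0, 2 * pi], continuous theta} /\
  forall s : R, s \in `[0, 2 * pi] -> psi (circle_pt s) = circle_pt (theta s).

(* (1 / 2 pi) times the total change of the angle of psi (e^(is)) as s runs
   from 0 to 2 pi. For a continuous psi from the circle to itself such a k
   exists and is unique, so the default value 0 is never used:
   see winding_numberP and winding_number_eq. *)
Definition winding_number (R : realType) (psi : R * R -> R * R) : int :=
  xget 0 [set k : int | exists theta : R -> R,
    angle_lift psi theta /\ theta (2 * pi) - theta 0 = 2 * pi * k%:~R].

Lemma cos_eq1_2pi (R : realType) (x : R) :
  cos x = 1 -> exists k : int, x = 2 * pi * k%:~R.
Proof.
move=> cx.
have pi0 : 0 < (pi : R) := pi_gt0 R.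
have perZ (k : int) (y : R) : cos (y + 2 * pi * k%:~R) = cos y.
  have perN (n : nat) (z : R) : cos (z + 2 * pi * n%:R) = cos z.
    by rewrite mulr_natl mulr_natr (periodicn (@cosD2pi R)).
  case: k => n; first exact: perN.
  rewrite NegzE -[LHS](perN n.+1); congr cos.
  by rewrite mulrNz -pmulrn; ring.
pose k := Num.floor (x / (2 * pi)).
exists k; apply/eqP; rewrite -subr_eq0; apply/eqP.
set r := x - _.
have cr : cos r = 1.
  by rewrite -cx -(perZ k r); congr cos; rewrite /r; ring.
have /andP[r0 r2] : 0 <= r < 2 * pi.
  have /andP[k1 k2] := floor_itv (x / (2 * pi)).
  rewrite ler_pdivlMr ?mulr_gt0// in k1.
  rewrite ltr_pdivrMr ?mulr_gt0// intrD in k2.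
  rewrite /r/k; apply/andP; split; lra.
have [rpi|pir] := leP r pi.
  by apply: (@cos_inj R); rewrite ?in_itv/= ?r0 ?lexx ?(ltW pi0)// cos0.
have : cos (2 * pi - r) = cos 0.
  by rewrite cos0 -[RHS]cr -[RHS]cosN -[RHS](perZ 1); congr cos; ring.
move/(@cos_inj R); rewrite !in_itv/= lexx (ltW pi0)/= => H.
have := H ltac:(lra) isT; lra.
Qed.

Lemma circle_angle (R : realType) (p : R * R) :
  circle p -> exists a : R, p = circle_pt a.
Proof.
case: p => x y; rewrite /circle /norm2 /= => h.
have {}h : x ^+ 2 + y ^+ 2 = 1.
  by rewrite -[LHS]sqr_sqrtr ?addr_ge0 ?sqr_ge0// h expr1n.
have x1 : -1 <= x <= 1.
  have := sqr_ge0 y; nra.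
have x2 : 1 - x ^+ 2 = y ^+ 2 by lra.
exists (if 0 <= y then acos x else - acos x); rewrite /circle_pt.
case: ifPn => y0.
  by rewrite acosK ?in_itv//= sin_acos// x2 sqrtr_sqr ger0_norm.
rewrite -ltNge in y0.
by rewrite cosN sinN acosK ?in_itv//= sin_acos// x2 sqrtr_sqr ltr0_norm// opprK.
Qed.

Lemma angle_step (R : realType) (a x y : R) :
  x ^+ 2 + y ^+ 2 = 1 ->
  let d := cos a * x + sin a * y in
  0 < d ->
  let b := a + atan ((cos a * y - sin a * x) / d) in
  cos b = x /\ sin b = y.
Proof.
move=> xy d d0 b.
set c := cos a * y - sin a * x in b *.
have cs := cos2Dsin2 a.
have dc : d ^+ 2 + c ^+ 2 = 1.
  transitivity ((cos a ^+ 2 + sin a ^+ 2) * (x ^+ 2 + y ^+ 2)).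
    by rewrite /d /c; ring.
  by rewrite cs xy mulr1.
have dn0 : d != 0 by rewrite gt_eqF.
have ca : cos (atan (c / d)) = d.
  rewrite cos_atan.
  have -> : 1 + (c / d) ^+ 2 = d ^- 2.
    by rewrite -[1 in LHS](divff (expf_neq0 2 dn0)) expr_div_n -mulrDl dc div1r.
  by rewrite sqrtrV ?sqr_ge0// invrK sqrtr_sqr gtr0_norm.
have sa : sin (atan (c / d)) = c.
  have := atanK (c / d); rewrite /tan ca => h.
  by rewrite -[LHS](divfK dn0) h divfK.
rewrite /b cosD sinD ca sa /c /d; split.
  transitivity ((cos a ^+ 2 + sin a ^+ 2) * x); [ring|by rewrite cs mul1r].
transitivity ((cos a ^+ 2 + sin a ^+ 2) * y); [ring|by rewrite cs mul1r].
Qed.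

Lemma continuous_lift (R : realType) (C S : R -> R) (L : R) :
  0 <= L -> continuous C -> continuous S ->
  (forall s, C s ^+ 2 + S s ^+ 2 = 1) ->
  exists theta : R -> R, continuous theta /\
    forall s, s \in `[0, L] -> cos (theta s) = C s /\ sin (theta s) = S s.
Proof.
move=> L0 cC cS CS.
have [d d0 hd] : exists2 d : R, 0 < d & forall x y, x \in `[0, L] ->
    `|x - y| < d -> 0 < C x * C y + S x * S y.
  have := (compact_near_coveringP _).1 (@segment_compact R 0 L).
  move=> /(_ R (0^'+) (fun d x => forall y, `|x - y| < d ->
    0 < C x * C y + S x * S y) _).
  case.
    move=> x0 _.
    have H : \forall z \near (x0, x0), 0 < C z.1 * C z.2 + S z.1 * S z.2.
      have cf : {for (x0, x0), continuous (fun z : R * R =>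
          C z.1 * C z.2 + S z.1 * S z.2 : R)}.
        have c1 (G : R -> R) : continuous G ->
            {for (x0, x0), continuous (fun z : R * R => G z.1)}.
          move=> cG; apply: (@continuous_comp _ _ _ fst G); last exact: cG.
          exact: cvg_fst.
        have c2 (G : R -> R) : continuous G ->
            {for (x0, x0), continuous (fun z : R * R => G z.2)}.
          move=> cG; apply: (@continuous_comp _ _ _ snd G); last exact: cG.
          exact: cvg_snd.
        apply: (@cvgD _ R^o).
          by apply: (@cvgM R); [exact: c1|exact: c2].
        by apply: (@cvgM R); [exact: c1|exact: c2].
      apply: (cf [set r | 0 < r]).
      by apply: open_nbhs_nbhs; split; [exact: open_gt|rewrite /= -!expr2 CS].
    have [e /= e0 He] := (nbhs_ballP _ _).1 H.
    exists (ball x0 (e / 2), [set r | 0 < r < e / 2]) => /=.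
      split; first by apply: nbhsx_ballx; rewrite divr_gt0.
      exists (e / 2); first by rewrite /= divr_gt0.
      by move=> r /=; rewrite sub0r normrN => re r0; rewrite r0/= (le_lt_trans _ re)// ler_norm.
    move=> [x r] /= [xx0 /andP[r0 re]] y xy.
    apply: (He (x, y)); split => /=; rewrite /ball/= in xx0 *.
      by apply: lt_trans xx0 _; lra.
    rewrite -(subrKA x) (le_lt_trans (ler_normD _ _))//; lra.
  move=> e /= e0 he; exists (e / 2); first by rewrite divr_gt0.
  move=> x y xL; apply: (he (e / 2)) => //=; last by rewrite divr_gt0.
  by rewrite sub0r normrN gtr0_norm; lra.
have d20 : 0 < d / 2 by rewrite divr_gt0.
pose kap (k : nat) (s : R) : R := Num.max 0 (Num.min s (Num.min (k%:R * (d / 2)) L)).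
have ckap k : continuous (kap k).
  move=> s; apply: (@continuous_max R R (fun=> 0)
    (fun s => Num.min s (Num.min (k%:R * (d / 2)) L))); first exact: cvg_cst.
  apply: (@continuous_min R R id (fun=> Num.min (k%:R * (d / 2)) L)).
    exact: cvg_id.
  exact: cvg_cst.
have kapL k s : kap k s \in `[0, L].
  by rewrite in_itv/= /kap le_max lexx/= ge_max L0 !ge_min lexx !orbT.
have kapS k s : `|kap k s - kap k.+1 s| < d.
  have kS : k.+1%:R * (d / 2) = k%:R * (d / 2) + d / 2.
    by rewrite -(@natr1 _ k) mulrDl mul1r.
  rewrite /kap kS.
  have : 0 <= k%:R * (d / 2) by rewrite mulr_ge0// ltW.
  move: (k%:R * (d / 2)) => t t0.
  apply: (@le_lt_trans _ _ (d / 2)); last by lra.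
  rewrite ler_norml; apply/andP; split; rewrite /Num.max /Num.min;
    repeat (case: ifPn; rewrite -?leNgt); intros; lra.
have lifts k : exists theta : R -> R, continuous theta /\
    forall s, cos (theta s) = C (kap k s) /\ sin (theta s) = S (kap k s).
  elim: k => [|k [th [cth hth]]].
    have [a [aC aS]] : exists a : R, (C 0, S 0) = circle_pt a.
      by apply: circle_angle; rewrite /circle/norm2/= CS sqrtr1.
    exists (fun=> a); split; first by move=> s; exact: cvg_cst.
    move=> s; have -> : kap 0%N s = 0.
      by rewrite /kap mul0r (min_l L0); apply/max_idPl; rewrite ge_min lexx orbT.
    by rewrite aC aS.
  exists (fun s => th s + atan ((C (kap k s) * S (kap k.+1 s)
    - S (kap k s) * C (kap k.+1 s)) / (C (kap k s) * C (kap k.+1 s)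
    + S (kap k s) * S (kap k.+1 s)))); split.
    have cCk j : continuous (C \o kap j).
      by move=> s; apply: continuous_comp; [exact: ckap|exact: cC].
    have cSk j : continuous (S \o kap j).
      by move=> s; apply: continuous_comp; [exact: ckap|exact: cS].
    move=> s; apply: (@cvgD _ R^o); first exact: cth.
    apply: (@continuous_comp _ _ _ (fun s => (C (kap k s) * S (kap k.+1 s)
      - S (kap k s) * C (kap k.+1 s)) / (C (kap k s) * C (kap k.+1 s)
      + S (kap k s) * S (kap k.+1 s))) (@atan R)); last exact: continuous_atan.
    apply: (@cvgM R).
      apply: (@cvgB _ R^o); apply: (@cvgM R);
        [exact: cCk|exact: cSk|exact: cSk|exact: cCk].
    apply: (@cvgV R); first by rewrite gt_eqF// hd.
    apply: (@cvgD _ R^o); apply: (@cvgM R);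
      [exact: cCk|exact: cCk|exact: cSk|exact: cSk].
  move=> s; have [h1 h2] := hth s; rewrite -h1 -h2.
  by apply: angle_step; [exact: CS|rewrite h1 h2; exact: hd].
pose N := (Num.truncn (L / (d / 2))).+1.
have [th [cth hth]] := lifts N.
exists th; split => // s sL; have := hth s.
suff -> : kap N s = s by [].
have : L < N%:R * (d / 2) by rewrite -ltr_pdivrMr// truncnS_gt.
move=> LN; rewrite /kap (min_r (ltW LN)).
by move: sL; rewrite in_itv/= => /andP[s0 s1]; rewrite (min_l s1) (max_r s0).
Qed.

Lemma circle_circle_pt (R : realType) (s : R) : circle (circle_pt s).
Proof. by rewrite /circle /norm2/= cos2Dsin2 sqrtr1. Qed.

Lemma angle_lift_unique (R : realType) (psi : R * R -> R * R)
    (theta eta : R -> R) : angle_lift psi theta -> angle_lift psi eta ->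
  theta (2 * pi) - theta 0 = eta (2 * pi) - eta 0.
Proof.
move=> [ct ht] [ce he].
wlog le_et : theta eta ct ht ce he /
    eta (2 * pi) - eta 0 <= theta (2 * pi) - theta 0.
  move=> H; case: (leP (eta (2 * pi) - eta 0) (theta (2 * pi) - theta 0)) => h.
    exact: H.
  by apply/esym; apply: H => //; exact: ltW.
have pi0 : 0 < (pi : R) := pi_gt0 R.
pose D s := theta s - eta s.
have cD : {within `[0, 2 * pi], continuous D}.
  by move=> s; apply: cvgB; [exact: ct|exact: ce].
have D1 s : s \in `[0, 2 * pi] -> cos (D s) = 1 /\ sin (D s) = 0.
  move=> sI; have := ht s sI; rewrite (he s sI) => -[h1 h2].
  rewrite /D cosB sinB h1 h2; split; last by ring.
  by rewrite -!expr2 cos2Dsin2.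
have I0 : (0 : R) \in `[0, 2 * pi] by rewrite in_itv/= lexx mulr_ge0// ltW.
have I1 : (2 * pi : R) \in `[0, 2 * pi] by rewrite in_itv/= lexx mulr_ge0// ltW.
have [k hk] : exists k : int, D (2 * pi) - D 0 = 2 * pi * k%:~R.
  apply: cos_eq1_2pi; have [c0 s0] := D1 _ I0; have [c1 s1] := D1 _ I1.
  by rewrite cosB c0 c1 s0 s1; ring.
suff : D (2 * pi) - D 0 = 0 by rewrite /D; lra.
have Dge0 : 0 <= D (2 * pi) - D 0 by rewrite /D; lra.
have [k0|k0] := leP k 0.
  apply/eqP; rewrite eq_le Dge0 andbT hk.
  by rewrite mulr_ge0_le0 ?mulr_ge0 ?(ltW pi0)// lerz0.
have k1 : (1 : R) <= k%:~R by rewrite ler1z -gtz0_ge1.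
have Dpi : D 0 + pi <= D (2 * pi) by nra.
have le02 : 0 <= 2 * pi :> R by rewrite mulr_ge0// ltW.
have [|c cI Dc] := @IVT R D 0 (2 * pi) (D 0 + pi) le02 cD.
- have D02 : D 0 <= D (2 * pi) by lra.
  by rewrite (min_l D02) (max_r D02); lra.
- have [h _] := D1 c cI; move: h.
  by rewrite Dc cosDpi (D1 _ I0).1; lra.
Qed.

Lemma winding_number_eq (R : realType) (psi : R * R -> R * R)
    (theta : R -> R) (k : int) :
  angle_lift psi theta -> theta (2 * pi) - theta 0 = 2 * pi * k%:~R ->
  winding_number psi = k.
Proof.
move=> ht hk; apply: xget_unique; first by exists theta.
move=> j [eta [he hj]].
have := angle_lift_unique ht he; rewrite hk hj => /mulfI.
by rewrite mulf_neq0 ?gt_eqF ?pi_gt0// => /(_ isT)/intr_inj.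
Qed.

Lemma winding_numberP (R : realType) (psi : R * R -> R * R) :
  {within @circle R, continuous psi} ->
  (forall p, circle p -> circle (psi p)) ->
  exists theta : R -> R, angle_lift psi theta /\
    theta (2 * pi) - theta 0 = 2 * pi * (winding_number psi)%:~R.
Proof.
move=> cpsi psiC.
have cF : continuous (psi \o @circle_pt R).
  move=> s; have /subspace_continuousP/(_ (circle_pt s)) := cpsi.
  move=> /(_ (circle_circle_pt s)); apply: cvg_comp.
  move=> U; rewrite /= nbhs_simpl/= => UU.
  have cp : circle_pt x @[x --> s] --> circle_pt s.
    exact: (cvg_pair (@continuous_cos R s) (@continuous_sin R s)).
  apply: (@filterS _ (nbhs s) _ _ _ _ (cp _ UU)) => t /=.
  by apply; exact: circle_circle_pt.
have [| | |s|theta [ct ht]] := @continuous_lift R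
    (fun s => (psi (circle_pt s)).1) (fun s => (psi (circle_pt s)).2) (2 * pi).
- by rewrite mulr_ge0// pi_ge0.
- by move=> s; apply: continuous_comp; [exact: cF|exact: cvg_fst].
- by move=> s; apply: continuous_comp; [exact: cF|exact: cvg_snd].
- have := psiC _ (circle_circle_pt s); rewrite /circle/norm2/= => h.
  by rewrite -[LHS]sqr_sqrtr ?addr_ge0 ?sqr_ge0// h expr1n.
have lift : angle_lift psi theta.
  split; first exact: continuous_subspaceT.
  move=> s /ht[c1 c2]; rewrite /circle_pt c1 c2; by case: (psi _).
have pi0 : 0 < (pi : R) := pi_gt0 R.
have I0 : (0 : R) \in `[0, 2 * pi] by rewrite in_itv/= lexx mulr_ge0// ltW.
have I1 : (2 * pi : R) \in `[0, 2 * pi] by rewrite in_itv/= lexx mulr_ge0// ltW.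
have [k hk] : exists k : int, theta (2 * pi) - theta 0 = 2 * pi * k%:~R.
  apply: cos_eq1_2pi; have := lift.2 _ I1; have := lift.2 _ I0.
  have -> : circle_pt (2 * pi : R) = circle_pt 0.
    rewrite /circle_pt mulrC mulr_natr -[pi *+ 2]add0r.
    by rewrite cosD2pi sinD2pi.
  move=> -> [h1 h2]; rewrite cosB -h1 -h2 -!expr2; exact: cos2Dsin2.
by exists theta; split => //; rewrite (winding_number_eq lift hk).
Qed.

(* Main.v *)
(** By compactness of the circle, [psi_t] and [psi_u] are everywhere less
    than a right angle apart when [u] is close to [t]; two such maps have the same
    winding number, so the winding number is a locally constant function of the
    time, hence constant. *)
Require Import Defs.
From HB Require Import structures.
From mathcomp Require Import all_boot all_order all_algebra.
From mathcomp Require Import all_classical all_reals all_analysis.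

Set Implicit Arguments.
Unset Strict Implicit.
Unset Printing Implicit Defensive.

Import Order.TTheory GRing.Theory Num.Theory.
Import numFieldNormedType.Exports.

Local Open Scope classical_set_scope.
Local Open Scope ring_scope.

(** Since [f] sends [A] into [B], a neighbourhood within [B] pulls back to one within [A]. This lets
    total functions compose as maps between subspaces. *)
Lemma within_continuous_comp (X Y Z : topologicalType) (A : set X) (B : set Y)
    (f : X -> Y) (k : Y -> Z) :
  {within A, continuous f} -> {within B, continuous k} ->
  (forall x, A x -> B (f x)) -> {within A, continuous (k \o f)}.
Proof.
move=> /subspace_continuousP cf /subspace_continuousP ck fAB.
apply/subspace_continuousP => x Ax.
apply: cvg_comp (ck _ (fAB _ Ax)) => U; rewrite /within /= !nbhs_simpl /= => UU.
have := cf x Ax _ UU; rewrite /within /= !nbhs_simpl /=.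
by apply: filterS => y /= h Ay; exact: h (fAB _ Ay).
Qed.

Lemma continuous_comp_within (X Y Z : topologicalType) (B : set Y)
    (f : X -> Y) (k : Y -> Z) :
  continuous f -> {within B, continuous k} -> (forall x, B (f x)) ->
  continuous (k \o f).
Proof.
move=> cf ck fB; rewrite continuous_subspace_setT.
apply: (within_continuous_comp _ ck) => [|x _]; last exact: fB.
exact: continuous_subspaceT.
Qed.

(** [cvg_pair] with points as limits, the form taken by the continuity goals below. *)
Lemma cvg_pair_nbhs (T : Type) (X Y : topologicalType) (F : set_system T)
    (FF : Filter F) (f : T -> X) (k : T -> Y) (x : X) (y : Y) :
  f z @[z --> F] --> x -> k z @[z --> F] --> y ->
  (f z, k z) @[z --> F] --> (x, y).
Proof. exact: cvg_pair. Qed.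

(** On unit vectors this is the cosine of the angle between them, so positivity says that they are
    less than a right angle apart. *)
Definition dot2 (R : realType) (x y : R * R) : R := x.1 * y.1 + x.2 * y.2.

Lemma continuous_dot2 (R : realType) (T : topologicalType) (f k : T -> R * R) :
  continuous f -> continuous k -> continuous (fun x => dot2 (f x) (k x)).
Proof.
move=> cf ck x; apply: (@cvgD _ R^o); apply: (@cvgM R).
- by apply: (@continuous_comp _ _ _ f fst); [exact: cf|exact: cvg_fst].
- by apply: (@continuous_comp _ _ _ k fst); [exact: ck|exact: cvg_fst].
- by apply: (@continuous_comp _ _ _ f snd); [exact: cf|exact: cvg_snd].
- by apply: (@continuous_comp _ _ _ k snd); [exact: ck|exact: cvg_snd].
Qed.

Lemma circle_sqr (R : realType) (p : R * R) :
  circle p -> p.1 ^+ 2 + p.2 ^+ 2 = 1.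
Proof.
rewrite /circle /norm2 /= => h.
by rewrite -[LHS]sqr_sqrtr ?addr_ge0 ?sqr_ge0// h expr1n.
Qed.

Lemma dot2_circle (R : realType) (p : R * R) : circle p -> dot2 p p = 1.
Proof. by move=> /circle_sqr; rewrite /dot2 -!expr2. Qed.

Lemma continuous_circle_pt (R : realType) : continuous (@circle_pt R).
Proof.
by move=> s; apply: cvg_pair_nbhs; [exact: continuous_cos|exact: continuous_sin].
Qed.

Lemma circle_pt_2pi (R : realType) : circle_pt (2 * pi : R) = circle_pt 0.
Proof.
by rewrite /circle_pt mulrC mulr_natr -[pi *+ 2]add0r cosD2pi sinD2pi.
Qed.

(* The angle from [psi p] to [psi' p] stays in (-pi/2, pi/2), so it is a
   continuous function of [p] given by an arctangent; being a function of [p],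
   it does not contribute to the total change of angle. *)
Lemma winding_number_dot2_gt0 (R : realType) (psi psi' : R * R -> R * R) :
  {within @circle R, continuous psi} -> {within @circle R, continuous psi'} ->
  (forall p, circle p -> circle (psi p)) ->
  (forall p, circle p -> circle (psi' p)) ->
  (forall s : R, s \in `[0, 2 * pi] ->
    0 < dot2 (psi (circle_pt s)) (psi' (circle_pt s))) ->
  winding_number psi' = winding_number psi.
Proof.
move=> cpsi cpsi' psiC psiC' dot_gt0.
have [theta [[ctheta htheta] dtheta]] := winding_numberP cpsi psiC.
have cF := continuous_comp_within (@continuous_circle_pt R) cpsi
  (@circle_circle_pt R).
have cF' := continuous_comp_within (@continuous_circle_pt R) cpsi'
  (@circle_circle_pt R).
(* A quarter turn: for unit vectors [p] and [q], [dot2 (rot p) q] is the sine of the angle from [p]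
   to [q], and its quotient by [dot2 p q] is the tangent. *)
pose rot (p : R * R) : R * R := (- p.2, p.1).
have crot : continuous (rot \o (psi \o @circle_pt R)).
  move=> s; apply: cvg_pair_nbhs.
    apply: (@cvgN _ R^o).
    by apply: (@continuous_comp _ _ _ (psi \o @circle_pt R) snd);
      [exact: cF|exact: cvg_snd].
  by apply: (@continuous_comp _ _ _ (psi \o @circle_pt R) fst);
    [exact: cF|exact: cvg_fst].
pose delta (p : R * R) : R :=
  atan (dot2 (rot (psi p)) (psi' p) / dot2 (psi p) (psi' p)).
apply: (@winding_number_eq _ _ (fun s => theta s + delta (circle_pt s))).
  split=> [|s sI].
    apply/subspace_continuousP => s sI; apply: (@cvgD _ R^o).
      by move/subspace_continuousP : ctheta; exact.
    apply: cvg_within_filter.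
    apply: (@continuous_comp _ _ _
      (fun s => dot2 (rot (psi (circle_pt s))) (psi' (circle_pt s)) /
                dot2 (psi (circle_pt s)) (psi' (circle_pt s))) (@atan R));
      last exact: continuous_atan.
    apply: (@cvgM R); first exact: (continuous_dot2 crot cF').
    apply: (@cvgV R); first by rewrite gt_eqF// dot_gt0.
    exact: (continuous_dot2 cF cF').
  (* As [psi (circle_pt s)] has angle [theta s], the quotient inside [delta] is the one in
     [angle_step], which turns [theta] into an angle of [psi']. *)
  have [] := angle_step (a := theta s) (circle_sqr (psiC' _ (circle_circle_pt s))).
    by have := dot_gt0 s sI; rewrite htheta.
  rewrite /delta /rot htheta// /circle_pt /dot2 /= mulNr (addrC (- _)).
  by move=> -> ->; rewrite -surjective_pairing.
(* The loop closes up, so the two end values of [delta] cancel and the total change is that of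
   [theta]. *)
by rewrite circle_pt_2pi -dtheta opprD addrACA subrr addr0.
Qed.

(** Every preimage under [w] is open, hence each fibre is also closed; a nonempty clopen subset of
    the connected line is the whole line. *)
Lemma locally_constant_eq (R : realType) (T : Type) (w : R -> T) :
  (forall t, \forall u \near t, w u = w t) -> forall t u, w t = w u.
Proof.
move=> loc t u.
have op (P : set T) : open (w @^-1` P).
  rewrite openE => v Pv; rewrite /interior /=.
  by apply: filterS (loc v) => z /= ->.
have /connected_intervalP cT : is_interval [set: R] by [].
have /seteqP[_ /(_ u I)] : w @^-1` [set w t] = [set: R].
  apply: cT; first by exists t.
    by exists (w @^-1` [set w t]); rewrite ?setTI.
  exists (w @^-1` [set w t]); rewrite ?setTI//.
  by rewrite -[X in closed X]setCK; apply: open_closedC; rewrite preimage_setC.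
by [].
Qed.

Lemma winding_number_homotopy (R : realType) (H : (R * R) * R -> R * R) :
  {within @circle R `*` `[0, 1], continuous H} ->
  (forall p t, circle p -> t \in `[0, 1] -> circle (H (p, t))) ->
  winding_number (fun p => H (p, 0)) = winding_number (fun p => H (p, 1)).
Proof.
move=> cH HC.
(* Clamping the time parameter makes the homotopy total. *)
pose tau (t : R) : R := Num.max 0 (Num.min t 1).
have ctau : continuous tau.
  move=> s; apply: (@continuous_max R R (fun=> 0) (fun s => Num.min s 1)).
    exact: cvg_cst.
  by apply: (@continuous_min R R id (fun=> 1)); [exact: cvg_id|exact: cvg_cst].
have tauI t : tau t \in `[0, 1].
  by rewrite in_itv/= /tau le_max lexx/= ge_max ler01 ge_min lexx orbT.
have cpsi t : {within @circle R, continuous (fun p => H (p, tau t))}.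
  apply: (@within_continuous_comp _ _ _ _ _ (fun p => (p, tau t)) _ _ cH).
    apply: continuous_subspaceT => p.
    by apply: cvg_pair_nbhs; [exact: cvg_id|exact: cvg_cst].
  by move=> p Cp; split => //=; exact: tauI.
have psiC t p : circle p -> circle (H (p, tau t)) by move=> /HC; exact.
(* In the angle coordinate the homotopy is continuous on the whole plane, and the compact segment
   [[0, 2 * pi]] stands in for the circle. *)
pose F (st : R * R) := H (circle_pt st.1, tau st.2).
have cF : continuous F.
  apply: (@continuous_comp_within _ _ _ _
    (fun st : R * R => (circle_pt st.1, tau st.2)) _ _ cH).
    move=> st; apply: cvg_pair_nbhs.
      by apply: continuous_comp; [exact: cvg_fst|exact: continuous_circle_pt].
    by apply: continuous_comp; [exact: cvg_snd|exact: ctau].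
  by move=> st; split => /=; [exact: circle_circle_pt|exact: tauI].
(* Clamping fixes both end times, so the claim compares two values of a function defined on all of
   [R]. *)
have -> : 0 = tau 0 by rewrite /tau (min_l ler01) maxxx.
have -> : 1 = tau 1 by rewrite /tau minxx (max_r ler01).
apply: (@locally_constant_eq _ _ (fun t => winding_number (fun p => H (p, tau t)))).
move=> t0.
(* Positivity near each [(s, t0)] yields, by compactness, one neighbourhood of [t0] that serves
   every [s] at once. *)
have := (compact_near_coveringP _).1 (@segment_compact R 0 (2 * pi)).
move=> /(_ R (nbhs t0) (fun t s => 0 < dot2 (F (s, t0)) (F (s, t))) _).
case=> [s _|e /= e0 he].
  have cdot : continuous (fun st : R * R => dot2 (F (st.1, t0)) (F st)).
    apply: continuous_dot2 => // st.
    apply: (@continuous_comp _ _ _ (fun st : R * R => (st.1, t0)) F); last exact: cF.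
    by apply: cvg_pair_nbhs; [exact: cvg_fst|exact: cvg_cst].
  (* At time [t0] a unit vector is paired with itself, giving 1; positivity is an open condition. *)
  apply: (cdot (s, t0) [set r | 0 < r]); apply: open_nbhs_nbhs.
  split; first exact: open_gt.
  rewrite /= dot2_circle//; exact/psiC/circle_circle_pt.
exists e => // t /he{}he; apply: winding_number_dot2_gt0 => //.
- exact: psiC.
- exact: psiC.
Qed.

Lemma norm2_gt0 (R : realType) (y : R * R) : y != (0, 0) -> 0 < norm2 y.
Proof.
case: y => a b y0; rewrite /norm2 sqrtr_gt0 lt0r addr_ge0 ?sqr_ge0// andbT /=.
by rewrite paddr_eq0 ?sqr_ge0// !sqrf_eq0; apply: contra y0 => /andP[/eqP-> /eqP->].
Qed.

Lemma circle_circle_proj (R : realType) (y : R * R) :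
  y != (0, 0) -> circle (circle_proj y).
Proof.
move=> /norm2_gt0 y0; rewrite /circle /= {1}/norm2 /= !exprMn -mulrDr.
have -> : y.1 ^+ 2 + y.2 ^+ 2 = norm2 y ^+ 2.
  by rewrite sqr_sqrtr ?addr_ge0 ?sqr_ge0.
by rewrite -exprMn mulVf ?gt_eqF// expr1n sqrtr1.
Qed.

Lemma continuous_circle_proj (R : realType) :
  {within [set y : R * R | y != (0, 0)], continuous (@circle_proj R)}.
Proof.
apply/subspace_continuousP => y /= y0; apply: cvg_within_filter.
have c1 : {for y, continuous (fun z : R * R => z.1)} by exact: cvg_fst.
have c2 : {for y, continuous (fun z : R * R => z.2)} by exact: cvg_snd.
have cV : {for y, continuous (fun z : R * R => (norm2 z)^-1)}.
  apply: (@cvgV R); first by rewrite gt_eqF ?norm2_gt0.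
  apply: (@continuous_comp _ _ _ (fun z : R * R => z.1 ^+ 2 + z.2 ^+ 2) (@Num.sqrt R));
    last exact: sqrt_continuous.
  by apply: (@cvgD _ R^o); apply: (@cvgM R).
apply: cvg_pair_nbhs;
  exact: (@cvgM R).
Qed.

Theorem proposition3p2 (R : realType) (n : nat) (g : R * R -> 'rV[R]_n)
  (hg : homeo_onto_image (@circle R) g)
  (Params : Type) (phi : R -> Params) (h : Params -> 'rV[R]_n -> R * R)
  (hcont : {within (g @` @circle R) `*` `[0, 1],
             continuous (fun xt : 'rV[R]_n * R => h (phi xt.2) xt.1)})
  (hnz : forall (t : R) (x : 'rV[R]_n), t \in `[0, 1] ->
           (g @` @circle R) x -> h (phi t) x != (0, 0)) :
  winding_number (@circle_proj R \o h (phi 0) \o g) =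
  winding_number (@circle_proj R \o h (phi 1) \o g).
Proof.
(* Continuity of [h] is given jointly over the image of [g]; this map pulls it back to the circle
   times [[0, 1]]. *)
have cgt : {within @circle R `*` `[0, 1],
    continuous (fun pt : (R * R) * R => (g pt.1, pt.2))}.
  apply/subspace_continuousP => -[p t] /= [Cp tI].
  apply: cvg_pair_nbhs; last first.
    by apply: cvg_within_filter; exact: cvg_snd.
  have : {within @circle R `*` `[0, 1], continuous (g \o @fst (R * R) R)}.
    apply: within_continuous_comp hg.1 _ => [|x []//].
    by apply: continuous_subspaceT => x; exact: cvg_fst.
  by move=> /subspace_continuousP/(_ (p, t)); apply.
have gtI (pt : (R * R) * R) : (@circle R `*` `[0, 1]) pt ->
    ((g @` @circle R) `*` `[0, 1]) (g pt.1, pt.2).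
  by move=> [Cp tI]; split => //=; exists pt.1.
(* The homotopy is the family of the theorem itself, with its values kept off the origin by
   [hnz]. *)
apply: (@winding_number_homotopy R
  (fun pt => circle_proj (h (phi pt.2) (g pt.1)))) => [|p t Cp tI].
  apply: (within_continuous_comp _ (@continuous_circle_proj R)).
    exact: (within_continuous_comp cgt hcont gtI).
  by move=> pt [Cp tI]; apply: hnz => //; exists pt.1.
by apply: circle_circle_proj; apply: hnz => //; exists p.
Qed.
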